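(* For $k\ge 5$, there exists no randomized algorithm for the $k$-MPMD problem on $K$-metrics against an oblivious adversary that has a competitive ratio which is bounded by a function of the number of points $n$.
   Context: The $k$-MPMD problem: a finite generalized metric space $(V,d)$ with $|V|=n$ and $d:V^k\to[0,\infty)$ is given. Requests arrive online; each request $\rho$ has a location $\ell(\rho)\in V$ and an arrival time $t(\rho)\ge 0$. The algorithm must irrevocably partition the request sequence $R$ (of size a multiple of $k$) into sets of exactly $k$ requests; a set can be formed at any time after all its members have arrived. Matching $\{\rho_1,\dots,\rho_k\}$ incurs space cost $d(\ell(\rho_1),\dots,\ell(\rho_k))$, and a request $\rho$ matched at time $t'(\rho)$ incurs time cost $t'(\rho)-t(\rho)$. The total cost is the sum of space and time costs; $\mathrm{cost}_{\mathcal{OPT}}(R)$ is the optimal offline cost. The competitive ratio of a randomized algorithm $\mathcal{ALG}$ is $\sup_R \mathbb{E}[\mathrm{cost}_{\mathcal{ALG}}(R)]/\mathrm{cost}_{\mathcal{OPT}}(R)$, with $R$ chosen by an oblivious adversary. A $K$-metric on $V$ (for $k$ points) is a function $d:V^k\to[0,\infty)$ such that for all $v_1,\dots,v_k,a\in V$: ($\Pi$) $d(v_1,\dots,v_k)$ is invariant under permutations of its arguments; ($O_D$) $d(v_1,\dots,v_k)=0$ if and only if $v_1=\dots=v_k$, and $d(v_1,\dots,v_k)>0$ otherwise; ($\Delta_n$) $d(v_1,\dots,v_k)\le d(v_1,\dots,v_{k-1},a)+d(a,\dots,a,v_k)$, where $a$ appears $k-1$ times in the last term; ($\mathcal{S}_K$)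 $d(v_1,\dots,v_1,v_2)\le d(v_1,v_2,\dots,v_k)$ whenever $v_2,\dots,v_k$ are distinct, where $v_1$ appears $k-1$ times on the left. *)

(* Defs.v *)
From HB Require Import structures.
From mathcomp Require Import all_boot all_order all_algebra.
From mathcomp Require Import finmap.
From mathcomp Require Import all_classical all_reals all_analysis.

Set Implicit Arguments.
Unset Strict Implicit.
Unset Printing Implicit Defensive.

Import Order.TTheory GRing.Theory Num.Theory.

Local Open Scope ring_scope.

(* Arguments are numbered from 0: v_1, ..., v_k are v 0, ...,
   v k.-1, and the values of v outside that range are irrelevant. *)
Record K_metric (R : realType) (k : nat) (V : finType)
    (d : k.-tuple V -> R) : Prop := {
  K_ge0 : forall s : k.-tuple V, 0 <= d s ;
  K_perm : forall s t : k.-tuple V, perm_eq s t -> d s = d t ;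
  K_eq0 : forall s : k.-tuple V, d s = 0 <-> constant s ;
  K_gt0 : forall s : k.-tuple V, ~~ constant s -> 0 < d s ;
  K_triangle : forall (v : nat -> V) (a : V),
    d [tuple v i | i < k] <=
      d [tuple (if i == k.-1 :> nat then a else v i) | i < k]
      + d [tuple (if i == k.-1 :> nat then v i else a) | i < k] ;
  K_simplex : forall v : nat -> V,
    {in [pred i | (0 < i < k)%N] &, injective v} ->
    d [tuple (if i == k.-1 :> nat then v 1%N else v 0%N) | i < k]
      <= d [tuple v i | i < k] }.

Section MPMD.
Context (R : realType) (k : nat) (V : finType).
Implicit Types d : k.-tuple V -> R.

Definition request : Type := (V * R)%type.
Definition location (r : request) : V := r.1.
Definition arrival (r : request) : R := r.2.

Implicit Types rs : seq request.

Definition instance rs : Prop :=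
  [/\ sorted (fun r r' => arrival r <= arrival r') rs,
      all (fun r => 0 <= arrival r) rs
    & (k %| size rs)%N].

(* A request is identified by its position in the request sequence; a schedule
   is the set of pairs (set of requests, time at which it is formed). *)
Definition schedule : Type := {fset {fset nat} * R}.

Implicit Types (A : {fset nat}) (S : schedule).

Definition members rs A : seq request :=
  mask [seq i \in A | i <- iota 0 (size rs)] rs.

Definition feasible rs S : Prop :=
  [/\ forall p, p \in S -> #|` p.1| = k,
      forall p, p \in S -> forall i, i \in p.1 -> (i < size rs)%N,
      forall i, (i < size rs)%N -> exists! p, p \in S /\ i \in p.1
    & forall p, p \in S -> forall r, r \in members rs p.1 -> arrival r <= p.2].

(* The default value 0 is used only for sets that do not have k members, which
   do not occur in a feasible schedule. *)
Definition space_cost d rs A : R :=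
  oapp d 0 (insub (map location (members rs A))).

Definition time_cost rs (p : {fset nat} * R) : R :=
  \sum_(r <- members rs p.1) (p.2 - arrival r).

Definition cost d rs S : R :=
  \sum_(p <- S) (space_cost d rs p.1 + time_cost rs p).

Definition opt_cost d rs : R :=
  inf [set cost d rs S | S in [set S | feasible rs S]]%classic.

(* The sets formed up to time t depend only on the requests that have arrived
   up to time t. As instances are sorted, these requests form a prefix, so their
   positions are the same in rs and rs'. *)
Definition online (alg : seq request -> schedule) : Prop :=
  forall (rs rs' : seq request) (t : R), instance rs -> instance rs' ->
    [seq r <- rs | arrival r <= t] = [seq r <- rs' | arrival r <= t] ->
    [fset p in alg rs | p.2 <= t]%fset = [fset p in alg rs' | p.2 <= t]%fset.

(* A probability distribution on deterministic online algorithms. *)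
Record randomized_algorithm d := {
  ra_disp : measure_display ;
  ra_space : measurableType ra_disp ;
  ra_prob : probability ra_space R ;
  ra_alg : ra_space -> seq request -> schedule ;
  ra_feasible : forall w rs, instance rs -> feasible rs (ra_alg w rs) ;
  ra_online : forall w, online (ra_alg w) ;
  ra_measurable : forall rs, instance rs ->
    measurable_fun [set: ra_space]%classic (fun w => cost d rs (ra_alg w rs)) }.

Definition expected_cost d (alg : randomized_algorithm d) rs : \bar R :=
  expectation (ra_prob alg) (fun w => cost d rs (ra_alg w rs)).

(* In the extended reals 0 / 0 = 0 and x / 0 = +oo for x > 0. *)
Definition competitive_ratio d (alg : randomized_algorithm d) : \bar R :=
  ereal_sup [set expected_cost alg rs / (opt_cost d rs)%:E
            | rs in [set rs | instance rs]]%classic%E.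

End MPMD.

(* Main.v *)
Require Import Defs.
From HB Require Import structures.
From mathcomp Require Import all_boot all_order all_algebra.
From mathcomp Require Import finmap.
From mathcomp Require Import all_classical all_reals all_analysis.
From mathcomp Require Import measurable_realfun lra zify.

(** Two points suffice.  On [{a, b}] let a [k]-tuple cost 1 if exactly one of
    its entries differs from all the others, and a tiny [eps] if it is any other
    non-constant tuple.  A change of one argument is then charged 1, the largest
    value of the metric, which gives the triangle inequality, and the simplex
    axiom is vacuous because [k - 1 > 2].  First release two
    [b]'s and [k - 2] [a]'s.  An algorithm that keeps them waiting up to
    time [tau] pays [tau] where [eps] was enough.  One that has matched them by
    then is given one [a] and [k - 1] [b]'s at time [2 * tau] and pays 1 for
    those, whereas regrouping all the requests as [3 + (k - 2)] [b]'s with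
    [(k - 3) + 2] [a]'s costs [2 * eps] plus the waiting time [2 * k * tau];
    this regrouping is where [k >= 5] is needed.  Hence pointwise
    [cost_1 / tau + cost_2 >= 1], an inequality that survives taking
    expectations, and [eps << tau << 1] gives the contradiction. *)

Set Implicit Arguments.
Unset Strict Implicit.
Unset Printing Implicit Defensive.

Import Order.TTheory GRing.Theory Num.Theory.

Local Open Scope ring_scope.

(** * Requests selected by a set of positions *)

Section Requests.
Context (R : realType) (V : finType).
Implicit Types (rs X Y : seq (request R V)) (A : {fset nat}).

(** Membership is tested on absolute positions, so the second block is read with its offset;
    [members] can then be computed block by block. *)
Lemma mask_mem_iota_cat A m X Y :
  mask [seq i \in A | i <- iota m (size (X ++ Y))] (X ++ Y) =
  mask [seq i \in A | i <- iota m (size X)] X ++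
  mask [seq i \in A | i <- iota (m + size X) (size Y)] Y.
Proof. by rewrite size_cat iotaD map_cat mask_cat // size_map size_iota. Qed.

Lemma mask_mem_iota A m X (b : bool) :
  (forall i, (m <= i < m + size X)%N -> (i \in A) = b) ->
  mask [seq i \in A | i <- iota m (size X)] X = if b then X else [::].
Proof.
elim: X m => [|x X IH] m Ab /=; first by case: b {Ab}.
rewrite IH => [|i mi]; last by apply: Ab => /=; lia.
by rewrite Ab /=; [case: b {Ab IH}|lia].
Qed.

Lemma members_all rs A :
  (forall i, (i < size rs)%N -> i \in A) -> members rs A = rs.
Proof. by move=> rsA; apply: (@mask_mem_iota A 0%N rs true) => i /rsA. Qed.

(** Both regroupings of the two batches take every other one of four consecutive blocks: [b] tells
    whether [A] takes the first and third or the second and fourth. *)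
Lemma members_alternate A X Y Z W (b : bool) :
  (forall i, (i < size X)%N -> (i \in A) = b) ->
  (forall i, (size X <= i < size X + size Y)%N -> (i \in A) = ~~ b) ->
  (forall i, (size (X ++ Y) <= i < size (X ++ Y) + size Z)%N ->
    (i \in A) = b) ->
  (forall i, (size (X ++ Y) + size Z <= i < size (X ++ Y) + size Z + size W)%N ->
    (i \in A) = ~~ b) ->
  members ((X ++ Y) ++ (Z ++ W)) A = if b then X ++ Z else Y ++ W.
Proof.
move=> Xb Yb Zb Wb; rewrite /members (mask_mem_iota_cat _ 0) add0n.
rewrite (mask_mem_iota_cat _ 0) (mask_mem_iota_cat _ (size (X ++ Y))) add0n.
rewrite (mask_mem_iota Yb) (mask_mem_iota Zb) (mask_mem_iota Wb).
rewrite (@mask_mem_iota _ 0%N _ b) => [|i]; last exact: Xb.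
by case: (b) => /=; rewrite ?cats0.
Qed.

Lemma mem_members rs A r : r \in members rs A -> r \in rs.
Proof. exact: mem_mask. Qed.

(** A subset of a finite set with the same cardinality is the whole set. *)
Lemma fset_eq_interval A (m k : nat) : #|` A| = k ->
  (forall i, i \in A -> (m <= i < m + k)%N) ->
  forall i, (i \in A) = (m <= i < m + k)%N.
Proof.
move=> cA Am i; pose B := [fset i in iota m k]%fset.
have inB j : (j \in B) = (m <= j < m + k)%N by rewrite !inE mem_iota.
rewrite -inB; apply/fsubset_cardP.
  by rewrite card_fseq undup_id ?iota_uniq// size_iota.
by apply/fsubsetP => j /Am; rewrite inB.
Qed.

Lemma pairwise_same_arrival X (u : R) :
  {in X, forall r, arrival r = u} ->
  pairwise (fun r r' => arrival r <= arrival r') X.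
Proof.
elim: X => //= x X IH Xu; rewrite IH ?andbT; last first.
  by move=> r rX; rewrite Xu// inE rX orbT.
by apply/allP => r rX; rewrite !Xu ?inE ?eqxx ?rX ?orbT.
Qed.

Lemma time_cost_le rs A u :
  {in rs, forall r, 0 <= arrival r} ->
  time_cost rs (A, u) <= (size (members rs A))%:R * u.
Proof.
move=> rs0; have -> : (size (members rs A))%:R * u = \sum_(r <- members rs A) u.
  by rewrite big_const_seq count_predT iter_addr_0 mulr_natl.
rewrite /time_cost /= !big_seq; apply: ler_sum => r /mem_members/rs0 r0.
by rewrite lerBlDr lerDl.
Qed.

(** * Costs of feasible schedules and the offline optimum *)

Context (k : nat) (d : k.-tuple V -> R).
Hypothesis d_ge0 : forall s, 0 <= d s.

Lemma space_cost_ge0 rs A : 0 <= space_cost d rs A.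
Proof. by rewrite /space_cost; case: insub => [t|] //=. Qed.

Lemma feasible_time_cost_ge0 rs S p :
  feasible k rs S -> p \in S -> 0 <= time_cost rs p.
Proof.
move=> [_ _ _ late] pS; rewrite /time_cost big_seq sumr_ge0// => r rp.
by rewrite subr_ge0 (late p pS).
Qed.

Lemma feasible_cost_ge rs S p : feasible k rs S -> p \in S ->
  space_cost d rs p.1 + time_cost rs p <= cost d rs S.
Proof.
move=> fS pS; rewrite /cost (big_fsetD1 p)//= lerDl big_seq sumr_ge0// => q.
rewrite in_fsetD => /andP[_ qS].
by rewrite addr_ge0 ?space_cost_ge0// (feasible_time_cost_ge0 fS).
Qed.

Lemma feasible_cost_ge0 rs S : feasible k rs S -> 0 <= cost d rs S.
Proof.
move=> fS; rewrite /cost big_seq sumr_ge0// => q qS.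
by rewrite addr_ge0 ?space_cost_ge0// (feasible_time_cost_ge0 fS).
Qed.

(** Costs of feasible schedules are bounded below by 0, so the infimum is a genuine lower bound. *)
Lemma opt_cost_le rs S : feasible k rs S -> opt_cost d rs <= cost d rs S.
Proof.
move=> fS; apply: ge_inf; last by exists S.
by exists 0 => _ [S' /feasible_cost_ge0 ? <-].
Qed.

Lemma opt_cost_ge0 rs S : feasible k rs S -> 0 <= opt_cost d rs.
Proof.
move=> fS; apply: lb_le_inf; first by exists (cost d rs S), S.
by move=> _ [S' /feasible_cost_ge0 ? <-].
Qed.

(** The set covering position 0 has [k] elements among only [k] positions, so it contains them
    all. *)
Lemma feasible_single_batch rs S : (0 < k)%N -> size rs = k ->
  feasible k rs S -> exists2 p, p \in S & forall i, (i \in p.1) = (i < k)%N.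
Proof.
move=> k0 szrs [card bnd cov _]; have [|p [[pS _] _]] := cov 0%N.
  by rewrite szrs.
exists p => // i; rewrite (@fset_eq_interval p.1 0%N k) ?card//.
by move=> j /(bnd _ pS); rewrite szrs.
Qed.

(** Once the first [k] positions form a set, the set covering position [k] must avoid them because
    each request is covered only once; its [k] elements then fill the remaining positions. *)
Lemma feasible_second_batch X Y S p : (0 < k)%N -> size X = k -> size Y = k ->
  feasible k (X ++ Y) S -> p \in S -> (forall i, (i \in p.1) = (i < k)%N) ->
  exists2 q, q \in S & members (X ++ Y) q.1 = Y.
Proof.
move=> k0 szX szY [card bnd cov _] pS pE.
have szXY : size (X ++ Y) = (k + k)%N by rewrite size_cat szX szY.
have [|q [[qS kq] _]] := cov k; first by rewrite szXY; lia.
have qE : forall i, (i \in q.1) = (k <= i < k + k)%N.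
  apply: fset_eq_interval; first exact: card.
  move=> i iq; rewrite -szXY (bnd q qS i iq) andbT leqNgt; apply/negP => ik.
  have [|x [_ xP]] := cov i; first by rewrite szXY; lia.
  have pq : p = q by rewrite -(xP p) ?pE// (xP q).
  by move: kq; rewrite -pq pE ltnn.
exists q => //; rewrite /members mask_mem_iota_cat.
rewrite (@mask_mem_iota q.1 0%N X false) => [|i]; last first.
  by rewrite qE szX => ?; lia.
by rewrite (@mask_mem_iota q.1 _ Y true) => // i; rewrite qE szX szY.
Qed.

(** * Expected costs of randomized algorithms *)

Lemma expected_cost_ge0 (alg : randomized_algorithm d) rs :
  instance k rs -> (0 <= expected_cost alg rs)%E.
Proof.
move=> Irs; apply: expectation_ge0 => w.
exact/feasible_cost_ge0/ra_feasible.
Qed.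

Lemma expected_cost_le (alg : randomized_algorithm d) rs S (F : R) :
  0 <= F -> instance k rs -> feasible k rs S ->
  (competitive_ratio alg <= F%:E)%E ->
  (expected_cost alg rs <= (F * cost d rs S)%:E)%E.
Proof.
move=> F0 Irs fS ratio.
have : (expected_cost alg rs / (opt_cost d rs)%:E <= F%:E)%E.
  by apply: le_trans ratio; apply: ereal_sup_ubound; exists rs.
have E0 := expected_cost_ge0 alg Irs.
(* If the optimum is 0, the ratio is [+oo] unless the expected cost is also 0, so the finite bound
   [F] forces a zero expected cost. *)
have := opt_cost_ge0 fS; rewrite le_eqVlt => /predU1P[<-|opt0].
  rewrite inve0; move: E0; rewrite le_eqVlt => /predU1P[<- _|E0].
    by rewrite lee_fin mulr_ge0// feasible_cost_ge0.
  by rewrite gt0_muley.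
rewrite inver gt_eqF// lee_pdivrMr// => /le_trans; apply.
by rewrite -EFinM lee_fin ler_wpM2l// opt_cost_le.
Qed.

(** Integrates the pointwise bound: the costs are measurable and nonnegative, so the integral is
    linear and monotone on them. *)
Lemma expected_cost_combination (alg : randomized_algorithm d) X Y (c : R) :
  0 <= c -> instance k X -> instance k Y ->
  (forall w, 1 <= c * cost d X (ra_alg (r := alg) w X)
                + cost d Y (ra_alg (r := alg) w Y)) ->
  (1 <= c%:E * expected_cost alg X + expected_cost alg Y)%E.
Proof.
move=> c0 IX IY ge1; rewrite /expected_cost unlock.
have cost_ge0 rs w : instance k rs -> 0 <= cost d rs (ra_alg (r := alg) w rs).
  by move=> ?; exact/feasible_cost_ge0/ra_feasible.
have mcost rs (Irs : instance k rs) :=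
  (measurable_EFinP _ _).2 (ra_measurable (r := alg) Irs).
rewrite -ge0_integralZl_EFin//; last exact: (mcost X IX).
2: by move=> w _; rewrite lee_fin cost_ge0.
rewrite -ge0_integralD//.
2: by move=> w _; rewrite -EFinM lee_fin mulr_ge0 ?cost_ge0.
2: by apply: measurable_funeM; exact: mcost.
2: by move=> w _; rewrite lee_fin cost_ge0.
2: exact: (mcost Y IY).
(* The constant 1 is its own expectation under a probability measure. *)
rewrite -[leLHS](expectation_cst (ra_prob alg) 1) unlock.
apply: ge0_le_integral => //.
- exact: (measurable_cst (1%E : \bar R)).
- apply: emeasurable_funD; last exact: (mcost Y IY).
  by apply: measurable_funeM; exact: (mcost X IX).
- by move=> w _; rewrite -EFinM -EFinD lee_fin.
Qed.

End Requests.

(** * Tuples over two points *)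

Lemma constant_bool (s : seq bool) :
  constant s = (count id s \in [:: 0%N; size s]).
Proof.
case: s => [|x s]; first by [].
rewrite !inE -all_count /=; case: x => /=.
  by apply: eq_all; case.
rewrite orbF add0n -[_ == 0%N]negbK -lt0n -has_count -all_predC.
by apply: eq_all; case.
Qed.

Lemma map_tupleE (T : Type) (k : nat) (f : nat -> T) :
  [tuple f i | i < k] = [seq f i | i <- iota 0 k] :> seq T.
Proof. by rewrite -val_enum_ord -map_comp. Qed.

(** * The two batches of requests and their offline schedules *)

Section Batches.
Context (R : realType) (k : nat).
Hypothesis k_ge5 : (5 <= k)%N.

(** The point [b] is [true] and [a] is [false]. The [false] requests are listed in two blocks
    because the regrouping separates the last two from the others; [batch2] is cut likewise. *)
Definition batch1 : seq (request R bool) :=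
  (nseq 2 (true, 0) ++ nseq (k - 4) (false, 0)) ++ nseq 2 (false, 0).

Definition batch2 (u : R) : seq (request R bool) :=
  [:: (false, u); (true, u)] ++ nseq (k - 2) (true, u).

Lemma size_batch1 : size batch1 = k.
Proof. by rewrite !size_cat !size_nseq; lia. Qed.

Lemma size_batch2 u : size (batch2 u) = k.
Proof. by rewrite !size_cat !size_nseq /=; lia. Qed.

Lemma size_batches u : size (batch1 ++ batch2 u) = (k + k)%N.
Proof. by rewrite size_cat size_batch1 size_batch2. Qed.

Lemma arrival_batch1 r : r \in batch1 -> arrival r = 0.
Proof. by rewrite !mem_cat !mem_nseq => /orP[/orP[]|] /andP[_ /eqP ->]. Qed.

Lemma arrival_batch2 u r : r \in batch2 u -> arrival r = u.
Proof.
rewrite mem_cat mem_nseq !inE => /orP[/orP[/eqP ->|/eqP ->]|] //.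
by move=> /andP[_ /eqP ->].
Qed.

Lemma arrival_batches u r : 0 <= u -> r \in batch1 ++ batch2 u ->
  0 <= arrival r <= u.
Proof.
move=> u0; rewrite mem_cat => /orP[/arrival_batch1 ->|/arrival_batch2 ->].
  by rewrite lexx.
by rewrite u0 lexx.
Qed.

Lemma instance_batch1 : instance k batch1.
Proof.
split; last by rewrite size_batch1 dvdnn.
  exact/pairwise_sorted/(pairwise_same_arrival arrival_batch1).
by apply/allP => r /arrival_batch1 ->.
Qed.

Lemma instance_batches u : 0 <= u -> instance k (batch1 ++ batch2 u).
Proof.
move=> u0; split.
- apply: pairwise_sorted; rewrite pairwise_cat.
  rewrite (pairwise_same_arrival arrival_batch1).
  rewrite (pairwise_same_arrival (@arrival_batch2 u)) !andbT.
  by apply/allrelP => r r' /arrival_batch1 -> /arrival_batch2 ->.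
- by apply/allP => r /(arrival_batches u0)/andP[].
- by rewrite size_batches dvdn_addr.
Qed.

Definition schedule1 : schedule R :=
  [fset ([fset i in iota 0 k]%fset, 0 : R)]%fset.

Lemma feasible_schedule1 : feasible k batch1 schedule1.
Proof.
have mem i : (i \in [fset i in iota 0 k]%fset) = (i < k)%N.
  by rewrite !inE mem_iota.
split => [p|p|i|p]; rewrite ?size_batch1; try by rewrite inE => /eqP ->;
  rewrite /= ?card_fseq ?undup_id ?iota_uniq ?size_iota// => i; rewrite mem.
  move=> ik; exists ([fset i in iota 0 k]%fset, 0); split.
    by rewrite inE eqxx mem.
  by move=> q [+ _]; rewrite inE => /eqP.
by rewrite inE => /eqP -> r /mem_members/arrival_batch1 ->.
Qed.

(** Positions [k] and [k + 1] hold the first two requests of the second batch, one [false] and one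
    [true]; they replace the last two [false] of the first batch. *)
Definition regroup1 : {fset nat} := [fset i in iota 0 (k - 2) ++ iota k 2]%fset.

Definition regroup2 : {fset nat} :=
  [fset i in iota (k - 2) 2 ++ iota (k + 2) (k - 2)]%fset.

Lemma mem_regroup1 i : (i \in regroup1) = ((i < k - 2) || (k <= i < k + 2))%N.
Proof.
rewrite (_ : (_ \in _) = (i \in iota 0 (k - 2) ++ iota k 2)) ?in_fset//.
by rewrite mem_cat !mem_iota.
Qed.

Lemma mem_regroup2 i :
  (i \in regroup2) = ((k - 2 <= i < k) || (k + 2 <= i < k + k))%N.
Proof.
rewrite (_ : (_ \in _) = (i \in iota (k - 2) 2 ++ iota (k + 2) (k - 2))) ?in_fset//.
by rewrite mem_cat !mem_iota; apply/idP/idP; lia.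
Qed.

Definition schedule2 (u : R) : schedule R :=
  [fset (regroup1, u); (regroup2, u)]%fset.

Lemma card_regroup1 : #|` regroup1| = k.
Proof.
rewrite card_fseq undup_id ?size_cat ?size_iota; first by lia.
rewrite cat_uniq !iota_uniq andbT andTb; apply/hasPn => i.
by rewrite !mem_iota; lia.
Qed.

Lemma card_regroup2 : #|` regroup2| = k.
Proof.
rewrite card_fseq undup_id ?size_cat ?size_iota; first by lia.
rewrite cat_uniq !iota_uniq andbT andTb; apply/hasPn => i.
by rewrite !mem_iota; lia.
Qed.

Lemma feasible_schedule2 u : 0 <= u ->
  feasible k (batch1 ++ batch2 u) (schedule2 u).
Proof.
move=> u0; split; rewrite ?size_batches.
- by move=> p; rewrite !inE => /orP[] /eqP -> /=;
    rewrite ?card_regroup1 ?card_regroup2.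
- by move=> p; rewrite !inE => /orP[] /eqP -> /= i;
    rewrite ?mem_regroup1 ?mem_regroup2; lia.
- move=> i ik; have [i1|i1] := boolP (i \in regroup1).
    exists (regroup1, u); split; first by split=> //; rewrite !inE eqxx.
    move=> q [+ iq]; rewrite !inE => /orP[/eqP //|/eqP qE]; exfalso.
    by move: iq i1; rewrite qE /= mem_regroup1 mem_regroup2; lia.
  exists (regroup2, u); split.
    split; first by rewrite !inE eqxx orbT.
    by move: i1; rewrite mem_regroup1 mem_regroup2; lia.
  move=> q [+ iq]; rewrite !inE => /orP[/eqP qE|/eqP //]; exfalso.
  by move: iq i1; rewrite qE /= => ->.
- move=> p; rewrite !inE => pE r /mem_members/(arrival_batches u0)/andP[_].
  by case/orP: pE => /eqP ->.
Qed.

Lemma members_regroup1 u : members (batch1 ++ batch2 u) regroup1 =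
  (nseq 2 (true, 0) ++ nseq (k - 4) (false, 0)) ++ [:: (false, u); (true, u)].
Proof.
apply: (@members_alternate _ _ _ _ _ _ _ true) => i;
  rewrite -?/batch1 ?size_batch1 ?size_cat ?size_nseq mem_regroup1 /= => ?; lia.
Qed.

Lemma members_regroup2 u : members (batch1 ++ batch2 u) regroup2 =
  nseq 2 (false, 0) ++ nseq (k - 2) (true, u).
Proof.
apply: (@members_alternate _ _ _ _ _ _ _ false) => i;
  rewrite -?/batch1 ?size_batch1 ?size_cat ?size_nseq mem_regroup2 /= => ?; lia.
Qed.

End Batches.

(** * The two-point metric and the costs of the schedules *)

Section TwoPoints.
Context (R : realType) (k : nat) (eps : R).
Hypotheses (k_ge5 : (5 <= k)%N) (eps_gt0 : 0 < eps) (eps_le1 : eps <= 1).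

(** The argument [c] is the number of entries equal to [true]. On two points it determines a tuple
    up to permutation, so the symmetry axiom becomes immediate. *)
Definition two_point_cost (c : nat) : R :=
  if c \in [:: 0%N; k] then 0 else if c \in [:: 1%N; k.-1] then 1 else eps.

Definition two_point_dist (s : k.-tuple bool) : R :=
  two_point_cost (count id s).

Lemma two_point_cost_ge0 c : 0 <= two_point_cost c.
Proof. by rewrite /two_point_cost; do 2!case: ifP => // _; exact: ltW. Qed.

Lemma two_point_cost_le1 c : two_point_cost c <= 1.
Proof. by rewrite /two_point_cost; do 2!case: ifP => // _; exact: ler01. Qed.

Lemma two_point_cost_gt0 c : c \notin [:: 0%N; k] -> 0 < two_point_cost c.
Proof. by rewrite /two_point_cost => /negbTE ->; case: ifP. Qed.

Lemma two_point_cost_eps c : (1 < c < k.-1)%N -> two_point_cost c = eps.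
Proof.
move=> c1; rewrite /two_point_cost !inE.
by do 4![case: eqVneq => [?|_] /=; first by lia].
Qed.

Lemma two_point_cost1 : two_point_cost 1 = 1.
Proof.
by rewrite /two_point_cost !inE /=; case: eqVneq => [?|//]; lia.
Qed.

Lemma two_point_cost_pred : two_point_cost k.-1 = 1.
Proof.
rewrite /two_point_cost !inE /= eqxx orbT.
by do 2![case: eqVneq => [?|_] /=; first by lia].
Qed.

Lemma count_last_differs (x : bool) :
  count id [seq (if i == k.-1 then x else ~~ x) | i <- iota 0 k]
  = if x then 1%N else k.-1.
Proof.
have -> : iota 0 k = iota 0 k.-1 ++ [:: k.-1].
  by rewrite -(iotaD 0 k.-1 1); congr iota; lia.
rewrite map_cat count_cat /= eqxx addn0 count_map.
rewrite (@eq_in_count _ _ (fun=> ~~ x)) => [|i]; last first.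
  by rewrite mem_iota /= => ik; rewrite ltn_eqF//; lia.
by case: x => /=; rewrite ?count_pred0 // count_predT size_iota addn0.
Qed.

Lemma two_point_K_metric : K_metric two_point_dist.
Proof.
split.
- by move=> s; exact: two_point_cost_ge0.
- by move=> s t /permP /(_ id) st; rewrite /two_point_dist st.
- move=> s; rewrite constant_bool size_tuple; split => [|cs].
    by apply: contraPT => /two_point_cost_gt0 /gt_eqF /eqP.
  by rewrite /two_point_dist /two_point_cost cs.
- move=> s; rewrite constant_bool size_tuple; exact: two_point_cost_gt0.
(* If [a] is the last entry, the first term on the right is already the left-hand side. Otherwise
   [a] is the other point, so the second term has exactly one deviating entry and equals 1, the
   maximum. *)
- move=> v a; have [<-|va] := eqVneq (v k.-1) a.
    rewrite -[leLHS]addr0 lerD ?two_point_cost_ge0//.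
    rewrite le_eqVlt; apply/orP; left; apply/eqP; congr two_point_dist.
    by apply: eq_mktuple => i; case: eqP => [->|].
  apply: le_trans (two_point_cost_le1 _) _.
  rewrite -[leLHS]add0r lerD ?two_point_cost_ge0//.
  rewrite /two_point_dist (map_tupleE k (fun i => if i == k.-1 then v i else a)).
  have -> : [seq (if i == k.-1 then v i else a) | i <- iota 0 k] =
            [seq (if i == k.-1 then v k.-1 else ~~ v k.-1) | i <- iota 0 k].
    by apply: eq_map => i; case: eqP => [->//|_]; move: va; case: a (v _) => -[].
  by rewrite count_last_differs; case: ifP; rewrite ?two_point_cost1 ?two_point_cost_pred.
- move=> v inj.
  (* Injectivity would make the entries at 1, 2 and 3 pairwise distinct, which is impossible among
     two booleans. *)
  have neq i j : (0 < i < k)%N -> (0 < j < k)%N -> i != j -> v i != v j.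
    by move=> ik jk; apply: contra => /eqP /inj -> //; rewrite inE.
  have := neq 1%N 2%N; have := neq 1%N 3%N; have := neq 2%N 3%N.
  have [k2 k3] : (2 < k)%N /\ (3 < k)%N by lia.
  have k1 : (1 < k)%N by lia.
  rewrite k1 k2 k3 /= => /(_ erefl erefl erefl) + /(_ erefl erefl erefl) +
    /(_ erefl erefl erefl).
  by case: (v 1%N) (v 2%N) (v 3%N) => -[] -[].
Qed.

Lemma space_cost_two_point (rs : seq (request R bool)) A :
  size (members rs A) = k ->
  space_cost two_point_dist rs A
  = two_point_cost (count (@location R bool) (members rs A)).
Proof.
move=> sz; rewrite /space_cost; case: insubP => [t _ tE|]; last first.
  by rewrite size_map sz eqxx.
by rewrite /= /two_point_dist tE count_map.
Qed.

Lemma cost_schedule1 : cost two_point_dist (batch1 R k) (schedule1 R k) = eps.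
Proof.
rewrite /cost big_seq_fset1 /=.
have mem : members (batch1 R k) [fset i in iota 0 k]%fset = batch1 R k.
  by apply: members_all => i; rewrite size_batch1// !inE mem_iota.
rewrite space_cost_two_point mem ?size_batch1//.
rewrite /time_cost /= mem big_seq big1 => [|r /arrival_batch1 ->]; last first.
  by rewrite subr0.
rewrite addr0 two_point_cost_eps// !count_cat !count_nseq /=; lia.
Qed.

Lemma cost_schedule2_le u : 0 <= u ->
  cost two_point_dist (batch1 R k ++ batch2 k u) (schedule2 k u)
  <= 2 * eps + 2 * k%:R * u.
Proof.
move=> u0.
have size1 : size (members (batch1 R k ++ batch2 k u) (regroup1 k)) = k.
  by rewrite members_regroup1// !size_cat !size_nseq /=; lia.
have size2 : size (members (batch1 R k ++ batch2 k u) (regroup2 k)) = k.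
  by rewrite members_regroup2// !size_cat !size_nseq /=; lia.
have arr0 : {in batch1 R k ++ batch2 k u, forall r, 0 <= arrival r}.
  by move=> r /(arrival_batches u0)/andP[].
have := time_cost_le (regroup1 k) u arr0.
have := time_cost_le (regroup2 k) u arr0.
rewrite size1 size2 /cost big_fsetU1 ?big_seq_fset1 /=; last first.
  (* Position 0 lies in only one of the two groups, so the schedule really has two sets and the cost
     splits into two summands. *)
  rewrite inE xpair_eqE eqxx andbT; apply/eqP => /fsetP/(_ 0%N).
  by rewrite mem_regroup1 mem_regroup2//; lia.
rewrite !space_cost_two_point// members_regroup1// members_regroup2//.
(* The groups contain 3 and [k - 2] entries [true]; [3 < k.-1] is the inequality that needs
   [5 <= k]. *)
rewrite !two_point_cost_eps; last 2 first.
- by rewrite !count_cat !count_nseq /=; lia.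
- by rewrite !count_cat !count_nseq /=; lia.
by lra.
Qed.

(** For each fixed [w], the time at which the first batch is matched when released alone decides
    which summand reaches 1; the weight [tau^-1] turns a wait longer than [tau] into at least 1. *)
Lemma online_cost_dichotomy (alg : randomized_algorithm two_point_dist)
    (tau : R) (w : ra_space alg) : 0 < tau ->
  1 <= tau^-1 * cost two_point_dist (batch1 R k) (ra_alg w (batch1 R k))
     + cost two_point_dist (batch1 R k ++ batch2 k (2 * tau))
         (ra_alg w (batch1 R k ++ batch2 k (2 * tau))).
Proof.
move=> tau0; set rs := batch1 R k ++ _; have k0 : (0 < k)%N by lia.
have d_ge0 (s : k.-tuple bool) : 0 <= two_point_dist s.
  exact: two_point_cost_ge0.
have Irs : instance k rs by apply: instance_batches => //; lra.
have I1 : instance k (batch1 R k) by exact: instance_batch1.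
have f1 := ra_feasible w I1; have f2 := ra_feasible w Irs.
have c1 := feasible_cost_ge0 d_ge0 f1; have c2 := feasible_cost_ge0 d_ge0 f2.
have [p pS pE] := feasible_single_batch k0 (size_batch1 R k_ge5) f1.
(* In the late case, all [k] requests arrived at time 0, so the time cost is [k] times [p.2], which
   exceeds [tau]. *)
have [ptau|taup] := leP p.2 tau; last first.
  rewrite -[leLHS]addr0 lerD// ler_pdivlMl// mulr1.
  apply: le_trans (feasible_cost_ge d_ge0 f1 pS).
  rewrite -[leLHS]add0r lerD ?space_cost_ge0//.
  rewrite /time_cost members_all => [|i]; last by rewrite size_batch1// pE.
  rewrite (eq_big_seq (fun=> p.2)) => [|r /arrival_batch1 ->]; last first.
    by rewrite subr0.
  rewrite big_const_seq count_predT iter_addr_0 size_batch1//.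
  apply: le_trans (ltW taup) _.
  by rewrite -mulr_natl ler_peMl ?ler1n// (le_trans (ltW tau0))// ltW.
(* The second batch arrives at [2 * tau], strictly after [tau], so at time [tau] the two instances
   are indistinguishable and the set [p] is formed in both. *)
have same_past : [seq r <- batch1 R k | arrival r <= tau] =
                 [seq r <- rs | arrival r <= tau].
  suff none : [seq r <- batch2 k (2 * tau) | arrival r <= tau] = [::].
    by rewrite [in RHS]filter_cat none cats0.
  apply/eqP; rewrite -[_ == _]negbK -has_filter; apply/hasPn => r.
  by move=> /arrival_batch2 ->; rewrite -ltNge; lra.
have pS2 : p \in ra_alg w rs.
  have /fsetP/(_ p) := ra_online w I1 Irs same_past.
  by rewrite !inE /= pS ptau => /esym/andP[].
(* The second batch is now matched by itself, and its single [false] among [k] requests costs 1. *)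
have [q qS qE] := feasible_second_batch k0 (size_batch1 R k_ge5)
  (size_batch2 k_ge5 _) f2 pS2 pE.
rewrite -[leLHS]add0r lerD//; first by rewrite mulr_ge0// invr_ge0 ltW.
apply: le_trans (feasible_cost_ge d_ge0 f2 qS).
rewrite -[leLHS]addr0 lerD ?(feasible_time_cost_ge0 f2)//.
rewrite space_cost_two_point qE ?size_batch2//.
have -> : count (@location R bool) (batch2 k (2 * tau)) = k.-1.
  by rewrite count_cat count_nseq /=; lia.
by rewrite two_point_cost_pred.
Qed.

End TwoPoints.

Theorem theorem4 (R : realType) (k : nat) (hk : (5 <= k)%N) :
  ~ exists (alg : forall (V : finType) (d : k.-tuple V -> R),
                    K_metric d -> randomized_algorithm d) (f : nat -> R),
      forall (V : finType) (d : k.-tuple V -> R) (Kd : K_metric d),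
        (competitive_ratio (alg V d Kd) <= (f #|V|)%:E)%E.
Proof.
move=> [alg [f ratio_le]].
(* The space is always [bool], so the bound [F] is fixed before [eps] and hence the metric are
   chosen. The maximum with 1 makes [F] positive whatever the values of [f]. *)
pose F := Num.max (f #|{: bool}|) 1.
have F1 : 1 <= F by rewrite le_max lexx orbT.
have K1 : 1 <= k%:R :> R by rewrite ler1n; lia.
(* These choices give [F * eps / tau = 1/4], [2 * F * eps = tau / 2] and [4 * F * k * tau = 1/4].
   The three add up to at most 17/32, since [tau <= 1/16], which contradicts the lower bound 1. *)
pose tau : R := (16 * F * k%:R)^-1; pose eps := tau / (4 * F).
have FK1 : 1 <= F * k%:R by rewrite mulr_ege1.
have tau0 : 0 < tau by rewrite invr_gt0; nra.
have tau1 : tau <= 16^-1 by rewrite lef_pV2 ?posrE; nra.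
have eps0 : 0 < eps by rewrite divr_gt0//; nra.
have epsE : 4 * F * eps = tau by rewrite mulrC divfK//; apply/eqP; nra.
have tauE : 16 * F * k%:R * tau = 1 by rewrite divff//; apply/eqP; nra.
have eps1 : eps <= 1 by nra.
pose d := two_point_dist (k := k) eps.
pose Kd : K_metric d := two_point_K_metric hk eps0 eps1.
have d_ge0 : forall s, 0 <= d s := K_ge0 Kd.
have ratio : (competitive_ratio (alg bool d Kd) <= F%:E)%E.
  by apply: le_trans (ratio_le _ _ _) _; rewrite lee_fin le_max lexx.
have u0 : 0 <= 2 * tau by lra.
have F0 : 0 <= F by lra.
have I1 := @instance_batch1 R k hk; have I2 := instance_batches hk u0.
have E1 := expected_cost_le d_ge0 F0 I1 (@feasible_schedule1 R k hk) ratio.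
have E2 := expected_cost_le d_ge0 F0 I2 (feasible_schedule2 hk u0) ratio.
have tauV0 : 0 <= tau^-1 by rewrite invr_ge0 ltW.
have := expected_cost_combination (alg := alg bool d Kd) d_ge0 tauV0 I1 I2
  (fun w => online_cost_dichotomy hk eps0 eps1 w tau0).
rewrite leNgt => /negP; apply.
apply: le_lt_trans (leeD (lee_wpmul2l _ E1) E2) _; first by rewrite lee_fin.
rewrite -EFinM -EFinD lte_fin cost_schedule1//.
have := cost_schedule2_le hk eps0 eps1 u0; rewrite -/d; set c2 := cost _ _ _ => c2_le.
have -> : tau^-1 * (F * eps) = 4^-1.
  by apply: (mulfI (lt0r_neq0 tau0)); rewrite mulrA divff ?gt_eqF// mul1r; lra.
have Fc2 : F * c2 <= F * (2 * eps + 2 * k%:R * (2 * tau)) by rewrite ler_wpM2l.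
by lra.
Qed.
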